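(* Every feasible point $(\bar x,\bar y)\in\mathbb{R}^n\times\mathbb{R}^n$ of the relaxed problem (RP) is an AKKT point for (RP).
   Context: Setting. Let $\alpha,n$ be natural numbers with $0<\alpha<n$, and let $f:\mathbb{R}^n\to\mathbb{R}$, $g:\mathbb{R}^n\to\mathbb{R}^m$, $h:\mathbb{R}^n\to\mathbb{R}^p$ be continuously differentiable. Let $e=(1,\ldots,1)\in\mathbb{R}^n$ and define $\theta(y)=n-\alpha-e^Ty\in\mathbb{R}$, $G(x)=x$, $H(y)=-y$, $\tilde H(y)=y-e$ for $x,y\in\mathbb{R}^n$. Let $*$ denote the componentwise (Hadamard) product; vector inequalities and the minimum $\min\{\cdot,\cdot\}$ of vectors are taken componentwise. The relaxed problem (RP) (a continuous reformulation of minimizing $f(x)$ subject to $g(x)\le 0$, $h(x)=0$ and $x$ having at most $\alpha$ nonzero components) is: minimize $f(x)$ over $(x,y)\in\mathbb{R}^n\times\mathbb{R}^n$ subject to $g(x)\le 0$, $h(x)=0$, $\theta(y)\le 0$, $H(y)\le 0$, $\tilde H(y)\le 0$, $G(x)*H(y)=0$. Definition (AKKT). For a general nonlinear program: minimize $F(z)$ over $z\in\mathbb{R}^N$ subject to $a(z)\le 0$, $b(z)=0$, with $F:\mathbb{R}^N\to\mathbb{R}$, $a:\mathbb{R}^N\to\mathbb{R}^M$, $b:\mathbb{R}^N\to\mathbb{R}^P$ continuously differentiable, a feasible point $\bar z$ is an Approximate KKT (AKKT) point if there exist sequences $(z^k)\subset\mathbb{R}^N$ and $(\lambda^{a,k},\lambda^{b,k})\subset\mathbb{R}_+^M\times\mathbb{R}^P$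 such that $z^k\to\bar z$, $\nabla F(z^k)+\sum_{i=1}^M\lambda_i^{a,k}\nabla a_i(z^k)+\sum_{j=1}^P\lambda_j^{b,k}\nabla b_j(z^k)\to 0$ and $\min\{-a(z^k),\lambda^{a,k}\}\to 0$. This definition is applied to (RP) with $z=(x,y)$, inequality constraints $g(x)\le 0$, $\theta(y)\le 0$, $H(y)\le 0$, $\tilde H(y)\le 0$, and equality constraints $h(x)=0$, $G(x)*H(y)=0$. *)

(* Defs.v *)
From mathcomp Require Export all_boot all_order all_algebra.
From mathcomp Require Export all_classical all_reals all_analysis.

Set Implicit Arguments.
Unset Strict Implicit.
Unset Printing Implicit Defensive.

Export Order.TTheory GRing.Theory Num.Theory.
Export numFieldNormedType.Exports.

Local Open Scope classical_set_scope.
Local Open Scope ring_scope.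

(* Vectors of R^n are row vectors 'rV[R]_n. *)

Definition vle (R : realType) (n : nat) (u v : 'rV[R]_n) : Prop :=
  forall i, u 0 i <= v 0 i.

Definition vmin (R : realType) (n : nat) (u v : 'rV[R]_n) : 'rV[R]_n :=
  map2_mx Num.min u v.

Definition hadamard (R : realType) (n : nat) (u v : 'rV[R]_n) : 'rV[R]_n :=
  map2_mx *%R u v.

Definition component (R : realType) (n m : nat) (F : 'rV[R]_n -> 'rV[R]_m)
  (i : 'I_m) : 'rV[R]_n -> R := fun x => F x 0 i.

Definition grad (R : realType) (n : nat) (F : 'rV[R]_n -> R) (x : 'rV[R]_n) :
  'rV[R]_n := \row_j 'D_(delta_mx 0 j) F x.

Definition C1 (R : realType) (n : nat) (F : 'rV[R]_n -> R) : Prop :=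
  (forall x, differentiable F x) /\ continuous (grad F).

Definition C1v (R : realType) (n m : nat) (F : 'rV[R]_n -> 'rV[R]_m) : Prop :=
  forall i, C1 (component F i).

(* minimize obj z  subject to  ineq z <= 0  and  eqc z = 0 *)
Record nlp (R : realType) (N M P : nat) := NLP {
  obj : 'rV[R]_N -> R;
  ineq : 'rV[R]_N -> 'rV[R]_M;
  eqc : 'rV[R]_N -> 'rV[R]_P }.

Definition feasible (R : realType) (N M P : nat) (Q : nlp R N M P)
  (z : 'rV[R]_N) : Prop := vle (ineq Q z) 0 /\ eqc Q z = 0.

Definition AKKT (R : realType) (N M P : nat) (Q : nlp R N M P)
  (zbar : 'rV[R]_N) : Prop :=
  feasible Q zbar /\
  exists (z : nat -> 'rV[R]_N) (la : nat -> 'rV[R]_M) (lb : nat -> 'rV[R]_P),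
    [/\ forall k, vle 0 (la k),
        z @ \oo --> zbar,
        (fun k => grad (obj Q) (z k)
                  + \sum_(i < M) la k 0 i *: grad (component (ineq Q) i) (z k)
                  + \sum_(j < P) lb k 0 j *: grad (component (eqc Q) j) (z k))
          @ \oo --> (0 : 'rV[R]_N) &
        (fun k => vmin (- ineq Q (z k)) (la k)) @ \oo --> (0 : 'rV[R]_M)].

Definition theta (R : realType) (n alpha : nat) (y : 'rV[R]_n) : R :=
  n%:R - alpha%:R - \sum_i y 0 i.

Definition Gmap (R : realType) (n : nat) (x : 'rV[R]_n) : 'rV[R]_n := x.

Definition Hmap (R : realType) (n : nat) (y : 'rV[R]_n) : 'rV[R]_n := - y.

Definition Htilde (R : realType) (n : nat) (y : 'rV[R]_n) : 'rV[R]_n :=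
  y - const_mx 1.

(* The variable (x, y) is the concatenation z = row_mx x y, and each family of
   constraints is concatenated into a single vector-valued constraint. *)
Definition RP (R : realType) (alpha n m p : nat) (f : 'rV[R]_n -> R)
  (g : 'rV[R]_n -> 'rV[R]_m) (h : 'rV[R]_n -> 'rV[R]_p) :
  nlp R (n + n) (m + (1 + (n + n))) (p + n) :=
  {| obj := fun z => f (lsubmx z);
     ineq := fun z =>
       row_mx (g (lsubmx z))
         (row_mx (const_mx (theta alpha (rsubmx z)))
            (row_mx (Hmap (rsubmx z)) (Htilde (rsubmx z))));
     eqc := fun z =>
       row_mx (h (lsubmx z)) (hadamard (Gmap (lsubmx z)) (Hmap (rsubmx z))) |}.

(* Main.v *)
(* Keep x fixed at xbar and perturb y only where ybar vanishes, by +-1/(k+1), so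
   that every coordinate of y^k is nonzero. The multiplier
   mu_i = (grad f(xbar))_i / y^k_i of the constraint x_i * (- y_i) = 0 then
   cancels the x-part of the Lagrangian gradient exactly, and the multiplier
   - mu_i * xbar_i of - y_i <= 0 cancels the y-part. The sign of the
   perturbation makes the latter nonnegative; it can be nonzero only where
   ybar_i = 0, so complementarity holds in the limit. All other multipliers
   are zero. *)
Require Import Defs.
From mathcomp Require Import lra.

Local Open Scope classical_set_scope.
Local Open Scope ring_scope.

(** The norm of a row vector is the maximum of its entries in absolute value, so a rate [C / (k+1)]
    common to all entries bounds the norm. *)
Lemma cvg_row_harmonic (R : realType) (N : nat) (C : R)
    (u : nat -> 'rV[R]_N) (l : 'rV[R]_N) :
  (forall k i, `|u k 0 i - l 0 i| <= C * k.+1%:R^-1) -> u @ \oo --> l.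
Proof.
move=> ubound.
have C_cvg0 : (fun k : nat => C * k.+1%:R^-1) @ \oo --> (0 : R).
  by rewrite -[0](mulr0 C); apply: cvgM; [exact: cvg_cst|exact: cvg_harmonic].
apply/cvgrPdist_le => e e_gt0.
have /cvgrPdist_le /(_ e e_gt0) := C_cvg0.
apply: filterS => k; rewrite sub0r normrN => /(le_trans (ler_norm _)) Ck.
rewrite distrC [leLHS]mx_normrE.
apply/bigmax_leP; split; first exact: ltW.
move=> [i j] _ /=; rewrite !mxE (ord1 i).
exact: le_trans (ubound k j) Ck.
Qed.

Lemma is_derive_coord {R : realType} {N : nat} (x v : 'rV[R]_N) (i : 'I_N) :
  is_derive x v (fun z : 'rV[R]_N => z 0 i) (v 0 i).
Proof.
apply: DeriveDef; first exact/diff_derivable/differentiable_coord.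
apply: cvg_lim => //; apply: cvg_near_cst.
(* A coordinate is linear: its difference quotient equals [v 0 i] exactly for every [t != 0]. *)
near=> t; rewrite /= !mxE addrK.
have t0 : t != 0 by near: t; exact: nbhs_dnbhs_neq.
exact: mulKf.
Unshelve. all: by end_near.
Qed.

(** Along [v] the difference quotients are those of [F] along [lsubmx v], and this direction is zero
    for the last [M] basis vectors. *)
Lemma grad_lsubmx (R : realType) (N M : nat) (F : 'rV[R]_N -> R)
    (z : 'rV[R]_(N + M)) :
  grad (fun w : 'rV_(N + M) => F (lsubmx w)) z = row_mx (grad F (lsubmx z)) 0.
Proof.
have deriveE (v : 'rV[R]_(N + M)) :
    'D_v (fun w : 'rV_(N + M) => F (lsubmx w)) z
    = 'D_(lsubmx v) F (lsubmx z).
  rewrite /derive; set u := (X in lim (X @ _)); set u' := (X in _ = lim (X @ _)).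
  suff -> : u = u' by [].
  apply/funext => t; rewrite /u /u' /=.
  suff -> : lsubmx (t *: v + z) = t *: lsubmx v + lsubmx z by [].
  by apply/rowP => i; rewrite !mxE.
apply/rowP => j; rewrite mxE deriveE.
case: (split_ordP j) => i ->.
  rewrite row_mxEl mxE; congr ('D_ _ F _).
  by apply/rowP => l; rewrite !mxE eq_lshift.
rewrite row_mxEr mxE.
have -> : lsubmx (delta_mx 0 (rshift N i)) = 0 :> 'rV[R]_N.
  by apply/rowP => l; rewrite !mxE eq_lrshift.
rewrite /derive (_ : (fun _ => _) = cst 0) ?lim_cst//.
by apply/funext => t /=; rewrite scaler0 add0r subrr scaler0.
Qed.

Lemma grad_Hmap (R : realType) (n : nat) (i : 'I_n) (z : 'rV[R]_(n + n)) :
  grad (fun w : 'rV[R]_(n + n) => - w 0 (rshift n i)) z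
  = row_mx 0 (- delta_mx 0 i).
Proof.
apply/rowP => j; rewrite mxE.
rewrite (@derive_val _ _ _ _ _ _ _
  (is_deriveN (is_derive_coord z (delta_mx 0 j) (rshift n i)))).
case: (split_ordP j) => l ->; rewrite ?row_mxEl ?row_mxEr !mxE eqxx /=.
  by rewrite eq_rlshift oppr0.
by rewrite eq_rshift eq_sym.
Qed.

(** The product rule swaps the roles: the x-block carries y_i and the y-block carries x_i. Dividing
    by y_i thus gives a multiplier that prescribes the x-block. *)
Lemma grad_hadamard (R : realType) (n : nat) (i : 'I_n) (z : 'rV[R]_(n + n)) :
  grad (fun w : 'rV[R]_(n + n) => w 0 (lshift n i) * - w 0 (rshift n i)) z
  = row_mx (- z 0 (rshift n i) *: delta_mx 0 i)
           (- z 0 (lshift n i) *: delta_mx 0 i).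
Proof.
apply/rowP => j; rewrite mxE.
rewrite (@derive_val _ _ _ _ _ _ _ (is_deriveM
  (is_derive_coord z (delta_mx 0 j) (lshift n i))
  (is_deriveN (is_derive_coord z (delta_mx 0 j) (rshift n i))))).
case: (split_ordP j) => l ->; rewrite ?row_mxEl ?row_mxEr !mxE !eqxx /=.
  by rewrite eq_rlshift eq_lshift [i == l]eq_sym oppr0 scaler0 add0r.
rewrite eq_lrshift eq_rshift [i == l]eq_sym scaler0 addr0.
by rewrite [LHS]mulrN [RHS]mulNr.
Qed.

(** Serves to discard a block of constraints whose multipliers vanish. *)
Lemma sum_lshift0 (V : nmodType) (M N : nat) (F : 'I_(M + N) -> V) :
  (forall i, F (lshift N i) = 0) -> \sum_i F i = \sum_i F (rshift M i).
Proof. by move=> F0; rewrite big_split_ord/= big1 ?add0r. Qed.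

Lemma sum_rshift0 (V : nmodType) (M N : nat) (F : 'I_(M + N) -> V) :
  (forall i, F (rshift M i) = 0) -> \sum_i F i = \sum_i F (lshift N i).
Proof. by move=> F0; rewrite big_split_ord/= [X in _ + X]big1 ?addr0. Qed.

Lemma sum_row_mx (R : realType) (N M q : nat) (a : 'I_q -> 'rV[R]_N)
    (b : 'I_q -> 'rV[R]_M) :
  \sum_i row_mx (a i) (b i) = row_mx (\sum_i a i) (\sum_i b i).
Proof.
elim/big_rec3: _ => [|i u v w _ ->]; first by rewrite row_mx0.
by rewrite add_row_mx.
Qed.

Lemma sum_scale_delta (R : realType) (n : nat) (a : 'I_n -> R) :
  \sum_i a i *: delta_mx 0 i = \row_i a i :> 'rV[R]_n.
Proof. by rewrite [RHS]row_sum_delta; apply: eq_bigr => i _; rewrite mxE. Qed.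

Theorem theorem4p1 (R : realType) (alpha n m p : nat)
  (f : 'rV[R]_n -> R) (g : 'rV[R]_n -> 'rV[R]_m) (h : 'rV[R]_n -> 'rV[R]_p)
  (alpha_gt0 : (0 < alpha)%N) (alpha_lt_n : (alpha < n)%N)
  (f_C1 : C1 f) (g_C1 : C1v g) (h_C1 : C1v h)
  (xbar ybar : 'rV[R]_n)
  (feas : feasible (RP alpha f g h) (row_mx xbar ybar)) :
  AKKT (RP alpha f g h) (row_mx xbar ybar).
Proof.
split=> //.
case: feas => ineq_le0 /rowP eqc_eq0.
have g_le0 i : g xbar 0 i <= 0.
  by have := ineq_le0 (lshift _ i); rewrite /= row_mxEl row_mxKl mxE.
have theta_le0 : theta alpha ybar <= 0.
  have := ineq_le0 (rshift m (lshift _ ord0)).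
  by rewrite /= row_mxEr row_mxEl row_mxKr !mxE.
have ybar_ge0 i : 0 <= ybar 0 i.
  have := ineq_le0 (rshift m (rshift 1 (lshift n i))).
  by rewrite /= 2!row_mxEr row_mxEl row_mxKr !mxE oppr_le0.
have ybar_le1 i : ybar 0 i <= 1.
  have := ineq_le0 (rshift m (rshift 1 (rshift n i))).
  by rewrite /= 3!row_mxEr row_mxKr !mxE subr_le0.
have xy0 i : ybar 0 i != 0 -> xbar 0 i = 0.
  have := eqc_eq0 (rshift p i).
  rewrite /= row_mxEr row_mxKl row_mxKr !mxE => /eqP.
  by rewrite mulf_eq0 oppr_eq0 => /orP[/eqP//|->].
pose c := grad f xbar.
(* The boolean is read as an exponent: the sign is -1 when [c 0 i * xbar 0 i] is positive and +1
   otherwise, opposite to that product unless it is zero. *)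
pose s i : R := if ybar 0 i == 0 then (-1) ^+ (0 < c 0 i * xbar 0 i)%R else 0.
pose eps (k : nat) : R := k.+1%:R^-1.
pose y k : 'rV[R]_n := \row_i (ybar 0 i + s i * eps k).
pose mu k : 'rV[R]_n := \row_i (c 0 i / y k 0 i).
pose lam k : 'rV[R]_n := \row_i - (mu k 0 i * xbar 0 i).
have eps_gt0 k : 0 < eps k by rewrite invr_gt0.
have s_le1 i : `|s i| <= 1.
  by rewrite /s; case: ifP => _; rewrite ?normr_sign// normr0.
have y_dist k i : `|y k 0 i - ybar 0 i| <= eps k.
  by rewrite mxE addrAC subrr add0r normrM (gtr0_norm (eps_gt0 k))
             ler_piMl// ltW.
have y_neq0 k i : y k 0 i != 0.
  rewrite mxE /s; case: ifPn => [/eqP->|ybar0]; last by rewrite mul0r addr0.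
  by rewrite add0r mulf_neq0 ?signr_eq0// gt_eqF.
have lam0 k i : ybar 0 i != 0 -> lam k 0 i = 0.
  by move=> /xy0 x0; rewrite mxE x0 mulr0 oppr0.
have lam_ge0 k i : 0 <= lam k 0 i.
  have [ybar0|/lam0 -> //] := eqVneq (ybar 0 i) 0.
  rewrite mxE [mu k 0 i]mxE [y k 0 i]mxE /s ybar0 eqxx add0r.
  (* A sign is its own inverse, so [lam] is minus the signed product [c 0 i * xbar 0 i], divided by
     [eps k]. *)
  rewrite mulrAC invfM invr_sign mulrA -mulNr.
  apply: mulr_ge0; last by rewrite invr_ge0 ltW.
  by case: ltP => cx; rewrite ?mulrN1 ?opprK ?mulr1 ?oppr_ge0 // ltW.
exists (fun k => row_mx xbar (y k)).
exists (fun k => row_mx 0 (row_mx 0 (row_mx (lam k) 0))).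
exists (fun k => row_mx 0 (mu k)).
split.
- move=> k j; rewrite mxE.
  case: (split_ordP j) => i ->; rewrite ?row_mxEl ?row_mxEr; first by rewrite mxE.
  case: (split_ordP i) => l ->; rewrite ?row_mxEl ?row_mxEr; first by rewrite mxE.
  case: (split_ordP l) => q ->; rewrite ?row_mxEl ?row_mxEr.
    exact: lam_ge0.
  by rewrite mxE.
- apply: (cvg_row_harmonic _ _ 1) => k i; rewrite mul1r.
  case: (split_ordP i) => j ->; rewrite ?row_mxEl ?row_mxEr//.
  by rewrite subrr normr0 ltW.
(* The sum vanishes for every [k]: the objective contributes [(c, 0)], the inequalities
   [(0, - lam k)] and the equalities [(- c, lam k)]. *)
- apply: cvg_near_cst; apply: nearW => k.
  have -> : \sum_(i < m + (1 + (n + n)))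
      row_mx 0 (row_mx 0 (row_mx (lam k) 0)) 0 i *:
      grad (component (ineq (RP alpha f g h)) i) (row_mx xbar (y k))
      = row_mx 0 (- lam k).
    rewrite sum_lshift0 => [|i]; last by rewrite row_mxEl mxE scale0r.
    rewrite sum_lshift0 => [|i]; last by rewrite row_mxEr row_mxEl mxE scale0r.
    rewrite sum_rshift0 => [|i]; last by rewrite !row_mxEr mxE scale0r.
    transitivity (\sum_(i < n)
        row_mx (0 : 'rV[R]_n) ((- lam k 0 i) *: delta_mx 0 i)).
      apply: eq_bigr => i _; rewrite 2!row_mxEr row_mxEl.
      rewrite (_ : component _ _ = fun w => - w 0 (rshift n i)).
        by rewrite grad_Hmap scale_row_mx scaler0 scalerN scaleNr.
      by apply/funext => w; rewrite /component /= 2!row_mxEr row_mxEl !mxE.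
    rewrite sum_row_mx big1// sum_scale_delta; congr row_mx.
    by apply/rowP => i; rewrite !mxE.
  have -> : \sum_(j < p + n) row_mx (0 : 'rV_p) (mu k) 0 j *:
      grad (component (eqc (RP alpha f g h)) j) (row_mx xbar (y k))
      = row_mx (- c) (lam k).
    rewrite sum_lshift0 => [|j]; last by rewrite row_mxEl mxE scale0r.
    transitivity (\sum_(j < n)
        row_mx (- c 0 j *: delta_mx 0 j : 'rV_n) (lam k 0 j *: delta_mx 0 j)).
      apply: eq_bigr => j _; rewrite row_mxEr.
      rewrite (_ : component _ _ =
          fun w => w 0 (lshift n j) * - w 0 (rshift n j)).
        rewrite grad_hadamard row_mxEl row_mxEr scale_row_mx !scalerA.
        by rewrite !mulrN [lam k _ _]mxE [mu k 0 j]mxE divfK.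
      by apply/funext => w; rewrite /component /= row_mxEr !mxE.
    rewrite sum_row_mx !sum_scale_delta.
    by congr row_mx; apply/rowP => j; rewrite !mxE.
  rewrite [obj _]/= grad_lsubmx row_mxKl -/c !add_row_mx.
  by rewrite addr0 add0r subrr addNr row_mx0.
(* The factor [n.+1] covers both the [n] perturbations summed in [theta] and the single [eps k] of
   the other blocks. *)
- apply: (cvg_row_harmonic _ _ (n.+1%:R)) => k i; rewrite -/(eps k).
  have eps_le (a : R) : `|a| <= eps k -> `|a| <= n.+1%:R * eps k.
    by move=> /le_trans; apply; rewrite ler_peMl ?ler1n// ltW.
  (* Under a zero multiplier only the constraint violation counts, not the slack. *)
  have min_le0 (a d : R) : 0 <= d -> - d <= a -> `|Num.min a 0| <= d.
    move=> d_ge0 a_ge; rewrite ler_norml le_min ge_min a_ge oppr_le0 d_ge0.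
    by rewrite orbT.
  have epsW := ltW (eps_gt0 k).
  rewrite [vmin _ _ 0 i]mxE [(- _ : 'rV_ _) 0 i]mxE [(0 : 'rV_ _) 0 i]mxE subr0.
  case: (split_ordP i) => i1 ->; rewrite /= ?row_mxEl ?row_mxEr.
    rewrite row_mxKl [(0 : 'rV_ _) 0 i1]mxE; apply/eps_le/min_le0 => //.
    by apply: le_trans (_ : 0 <= _); rewrite ?oppr_le0 ?oppr_ge0.
  rewrite row_mxKr.
  case: (split_ordP i1) => i2 ->; rewrite ?row_mxEl ?row_mxEr.
    rewrite [const_mx _ 0 i2]mxE [(0 : 'rV_ _) 0 i2]mxE.
    apply: min_le0; first by rewrite mulr_ge0.
    have sum_dist :
        \sum_(j < n) ybar 0 j - n%:R * eps k <= \sum_(j < n) y k 0 j.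
      rewrite -[n in n%:R]card_ord -sumr_const mulr_suml -sumrB.
      apply: ler_sum => j _; rewrite mul1r.
      by have := y_dist k j; rewrite ler_norml; lra.
    rewrite -addn1 natrD mulrDl mul1r.
    move: theta_le0 sum_dist epsW; rewrite /theta.
    lra.
  case: (split_ordP i2) => j ->; rewrite ?row_mxEl ?row_mxEr; apply: eps_le.
    rewrite [Hmap _ 0 j]mxE opprK.
    (* If [ybar 0 j] is zero, [lam] may be unbounded in [k], but the minimum is at most y_j, which
       is at most [eps k]; from below it is controlled by [lam >= 0]. *)
    have [ybar0|ybar0] := eqVneq (ybar 0 j) 0; last first.
      rewrite lam0//; apply: min_le0 => //.
      by have := y_dist k j; have := ybar_ge0 j; rewrite ler_norml; lra.
    have := y_dist k j.
    rewrite ybar0 subr0 !ler_norml le_min ge_min => /andP[-> ->] /=.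
    by rewrite andbT (le_trans _ (lam_ge0 k j))// oppr_le0.
  rewrite mxE [(0 : 'rV_ _) 0 j]mxE; apply: min_le0 => //.
  have := y_dist k j; have := ybar_le1 j.
  rewrite ler_norml !mxE; lra.
Qed.
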